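(* Let $t_0\in\mathbb{R}$, let $\ell_0,\ell_1\in V_{t_0}$, $\ell_0(1)(t)\ge\ell_1(1)(t)$ for a.e. $t\le t_0$, and let there exist $\kappa>0$ such that $f(v)(t)\ge0$ for a.e. $t\le t_0$ and every $v\in C_0(\mathbb{R};[0,\kappa])$. Let, moreover, there exist $\gamma\in AC_{loc}((-\infty,t_0];(0,+\infty))$ such that $\gamma'(t)\le-\ell_1(\gamma)(t)$ for a.e. $t\le t_0$. Assume, further, that $c\in(0,\kappa)$ and $u$ is a solution to the problem $u'(t)=\ell_0(u)(t)-\ell_1(u)(t)+f(u)(t)$, $u(t_0)=c$, on $(-\infty,t_0]$ satisfying $0\le u(t)\le\kappa$ for $t\le t_0$ and having a limit $u(-\infty)$. If there exists $\omega\in\Sigma$ such that $$\sup\left\{\int_{\omega(t)}^t\ell_1(1)(s)\,ds:\ t\le t_0\right\}<+\infty,$$ and either $$\limsup_{t\to-\infty}\int_{\omega(t)}^t\big[\ell_0(1)(s)-\ell_1(1)(s)\big]\,ds>0$$ or $f\in\mathcal{O}_{t_0}(\omega,\kappa,c)$, then $u(-\infty)=0$.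
   Context: Notation. $\mathbb{R}_+=[0,+\infty)$. $C_{loc}(\mathbb{R};\mathbb{R})$ is the space of continuous functions $\mathbb{R}\to\mathbb{R}$ with the topology of uniform convergence on every compact interval. $L_{loc}(\mathbb{R};\mathbb{R})$ is the space of locally Lebesgue-integrable functions on $\mathbb{R}$ with the topology of convergence in the mean on every compact interval. For $I,D\subseteq\mathbb{R}$: $C_0(I;D)$ is the set of bounded continuous functions $I\to D$; $AC_{loc}(I;D)$ is the set of functions $I\to D$ absolutely continuous on every compact interval contained in $I$; $L_{loc}(\mathbb{R};\mathbb{R}_+)$ is the set of functions $\mathbb{R}\to\mathbb{R}_+$ integrable on every compact interval. $u(-\infty)$ denotes the limit of $u$ at $-\infty$, if it exists. Standing assumptions. $\ell_0,\ell_1:C_{loc}(\mathbb{R};\mathbb{R})\to L_{loc}(\mathbb{R};\mathbb{R})$ are linear continuous operators which are positive (map non-negative functions to non-negative functions). $f:C_{loc}(\mathbb{R};\mathbb{R})\to L_{loc}(\mathbb{R};\mathbb{R})$ is a continuous operator satisfying the local Carathéodory conditions: for every $r>0$ there is $q_r\in L_{loc}(\mathbb{R};\mathbb{R}_+)$ with $|f(v)(t)|\le q_r(t)$ for a.e. $t\in\mathbb{R}$ whenever $\sup_{\mathbb{R}}|v|\le r$. If $I\subseteq\mathbb{R}$ is a closed interval, $u:I\to\mathbb{R}$ is continuous and $T:C_{loc}(\mathbb{R};\mathbb{R})\to L_{loc}(\mathbb{R};\mathbb{R})$ is a continuous operator, then $T(u):=T(\vartheta(u))$, where $\vartheta(u)$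 is the extension of $u$ to $\mathbb{R}$ equal to $u(\inf I)$ to the left of $I$ (if $\inf I>-\infty$) and $u(\sup I)$ to the right of $I$ (if $\sup I<+\infty$). $T(1)$ is the value of $T$ at the constant function $1$. For $\tau\in\mathbb{R}$, $V_\tau$ is the set of continuous operators $T:C_{loc}(\mathbb{R};\mathbb{R})\to L_{loc}(\mathbb{R};\mathbb{R})$ such that for every $\zeta\le\tau$, $T(u)(t)=T(v)(t)$ for a.e. $t\le\zeta$ whenever $u,v\in C_{loc}(\mathbb{R};\mathbb{R})$ and $u=v$ on $(-\infty,\zeta]$. $\Sigma$ is the set of continuous $\omega:\mathbb{R}\to\mathbb{R}$ with $\omega(t)\le t$ for all $t$. For $\omega\in\Sigma$, $\tau\in\mathbb{R}$, $\kappa>0$, $c\in(0,\kappa)$, an operator $T:C_{loc}(\mathbb{R};\mathbb{R})\to L_{loc}(\mathbb{R};\mathbb{R})$ belongs to $\mathcal{O}_\tau(\omega,\kappa,c)$ if $$\limsup_{t\to-\infty}\int_{\omega(t)}^tT(u)(s)\,ds>0$$ whenever $u\in C_0(\mathbb{R};[0,\kappa])$ is such that $u(\tau)=c$, there exists a finite limit $u(-\infty)\le c$, and: $0<u(-\infty)\le u(t)$ for $t\le\tau$ if $u(-\infty)<c$; $u(t)=c$ for $t\le\tau$ if $u(-\infty)=c$. A solution of the equation on a closed interval $I$ is a function $u:I\to\mathbb{R}$ absolutely continuous on every compact interval contained in $I$ and satisfying the equation a.e. on $I$ (with $\ell_0(u),\ell_1(u),f(u)$ understood via the extension $\vartheta(u)$).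 *)

(* Defs.v *)
From HB Require Import structures.
From mathcomp Require Import all_boot all_order all_algebra.
From mathcomp Require Import all_classical all_reals all_analysis.

Set Implicit Arguments.
Unset Strict Implicit.
Unset Printing Implicit Defensive.

Import Order.TTheory GRing.Theory Num.Theory.
Import numFieldNormedType.Exports.

Local Open Scope classical_set_scope.
Local Open Scope ring_scope.

(* An operator C_loc(R;R) -> L_loc(R;R) is a map on all functions R -> R of   *)
(* which only the values at continuous functions matter; equality in L_loc is *)
(* equality almost everywhere, so relations between values are stated a.e.    *)

Section operators.
Context {R : realType}.
Local Notation mu := (@lebesgue_measure R).
Implicit Types T : (R -> R) -> (R -> R).

Definition Lloc_valued T : Prop :=
  forall u : R -> R, continuous u -> locally_integrable [set: R] (T u).

(* Neighbourhoods of u in C_loc(R;R) are the traces, on the set of continuous *)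
(* functions, of those for uniform convergence on compact sets; convergence   *)
(* in L_loc(R;R) is convergence in the mean on every compact interval.        *)
Definition continuous_operator T : Prop :=
  Lloc_valued T /\
  forall u : R -> R, continuous u -> forall a b : R,
    (\int[mu]_(s in `[a, b]) `|T v s - T u s|%:E)%E
      @[v --> within [set v : R -> R | continuous v]
                (nbhs (u : {family compact, R -> R}))] --> 0%E.

Definition linear_operator T : Prop :=
  forall (a : R) (u v : R -> R), continuous u -> continuous v ->
    {ae mu, forall t, T (fun s => a * u s + v s) t = a * T u t + T v t}.

Definition positive_operator T : Prop :=
  forall u : R -> R, continuous u -> (forall t, 0 <= u t) ->
    {ae mu, forall t, 0 <= T u t}.

Definition local_caratheodory T : Prop :=
  forall r : R, 0 < r -> exists q : R -> R,
    [/\ locally_integrable [set: R] q, forall t, 0 <= q t &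
        forall v : R -> R, continuous v -> (forall t, `|v t| <= r) ->
          {ae mu, forall t, `|T v t| <= q t}].

Definition Volterra (tau : R) : set ((R -> R) -> (R -> R)) :=
  [set T | continuous_operator T /\
    forall zeta : R, zeta <= tau ->
    forall u v : R -> R, continuous u -> continuous v ->
      (forall t, t <= zeta -> u t = v t) ->
      {ae mu, forall t, t <= zeta -> T u t = T v t}].

Definition Sigma : set (R -> R) :=
  [set omega | continuous omega /\ forall t, omega t <= t].

Definition C0 (D : set R) : set (R -> R) :=
  [set v | [/\ continuous v, [bounded v t | t in [set: R]] &
               forall t, D (v t)]].

Definition Oclass (tau : R) (omega : R -> R) (kappa c : R) :
    set ((R -> R) -> (R -> R)) :=
  [set T | Lloc_valued T /\
    forall (u : R -> R) (uninf : R),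
      C0 `[0, kappa] u -> u tau = c ->
      u t @[t --> -oo] --> uninf -> uninf <= c ->
      (uninf < c -> 0 < uninf /\ forall t, t <= tau -> uninf <= u t) ->
      (uninf = c -> forall t, t <= tau -> u t = c) ->
      (0 < limf_esup (fun t => \int[mu]_(s in `[omega t, t]) (T u s)%:E)
             (-oo)%R)%E].

(* Functions on ]-oo, b] are represented by total functions, of which only    *)
(* the values on ]-oo, b] matter.                                             *)

(* vartheta(u) for u defined on the interval ]-oo, b]                         *)
Definition extend_const (b : R) (u : R -> R) : R -> R :=
  fun t => u (Num.min t b).

Definition abs_continuous_on (a b : R) (u : R -> R) : Prop :=
  forall e : R, 0 < e -> exists2 d : R, 0 < d &
    forall (n : nat) (x y : 'I_n -> R),
      (forall i, [/\ a <= x i, x i <= y i & y i <= b]) ->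
      trivIset [set: 'I_n] (fun i => [set` `]x i, y i[]) ->
      \sum_(i < n) (y i - x i) < d ->
      \sum_(i < n) `|u (y i) - u (x i)| < e.

Definition ACloc (I : set R) (D : set R) : set (R -> R) :=
  [set u | (forall t, I t -> D (u t)) /\
    forall a b : R, a <= b -> `[a, b] `<=` I -> abs_continuous_on a b u].

(* u' = l0(u) - l1(u) + f(u) a.e. on ]-oo, b]                                 *)
Definition solution (l0 l1 f : (R -> R) -> (R -> R)) (b : R) (u : R -> R) :
    Prop :=
  ACloc `]-oo, b] [set: R] u /\
  {ae mu, forall t, t <= b ->
    derivable u t 1 /\
    derive1 u t = l0 (extend_const b u) t - l1 (extend_const b u) t
              + f (extend_const b u) t}.

End operators.

(* Main.v *)
Require Import Defs.
From HB Require Import structures.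
From mathcomp Require Import all_boot all_order all_algebra.
From mathcomp Require Import all_classical all_reals all_analysis.
From mathcomp Require Import lra.
Import Order.TTheory GRing.Theory Num.Theory.
Import numFieldNormedType.Exports.
Local Open Scope classical_set_scope.
Local Open Scope ring_scope.

(** Write [u] also for its constant continuation to the right of [t0], and put
    [L = u(-oo)].

    The function [gamma] is a positive supersolution which makes it impossible
    for a nonnegative bounded [v] with [v' >= - l1 v] to reach zero at a time
    [ts] unless it vanished all along ([supersolution_vanishes_before_zero]):
    with [lam = sup v / gamma], the function [lam gamma - v] is nonnegative and,
    by positivity of [l1], nonincreasing, hence at least
    [eta = lam gamma(ts) > 0]; together with the bound on [v] this makes
    [v / gamma] stay below a constant smaller than [lam].

    Let [d >= 0] be a lower bound of [u]. Subtracting [d] from the equation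
    gives
      [(u - d)' = l0 (u - d) - l1 (u - d) + d (l0 1 - l1 1) + f u],
    in which the first term and the last two are nonnegative. So if [u] attains
    its minimum on ]-oo, t0] at [ts], then [u] is constant before [ts], and
    this minimum equals [L]; if the minimum is not attained, the infimum is
    again [L]. Either way [u >= L] ([limit_at_ninfty_le]), and [u = c] on
    ]-oo, t0] when [L = c]: this is what membership in the class O asks of
    [u].

    Suppose now [L > 0] and take [d = L]. Far to the left [0 <= u - L <= e], so
    by the Volterra property [l1 (u - L) <= e l1 1] there. Integrating over
    ]omega t, t[ bounds the integral of [L (l0 1 - l1 1) + f u] by [e (1 + M)],
    where [M] bounds the integrals of [l1 1]. As [e] is arbitrary, the bounded
    integrals tend to zero as [t] tends to [-oo], against either alternative of
    the hypothesis ([dominated_integrals_not_frequently_large]).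

    The passage from almost everywhere differential inequalities to increments
    rests on [abs_continuous_derive_ge0]: an absolutely continuous function
    with almost everywhere nonnegative derivative is nondecreasing. *)

Set Implicit Arguments.
Unset Strict Implicit.

#[global] Instance lebesgue_ae_filter (R : realType) :
    Filter (almost_everywhere (@lebesgue_measure R)) :=
  ae_filter_ringOfSetsType (@lebesgue_measure R).

(** * Absolutely continuous functions *)

Section absolute_continuity.
Context {R : realType}.
Local Notation mu := (@lebesgue_measure R).
Implicit Types (u v g : R -> R) (a b : R).

(** Induction along a compact interval: the supremum of the points reached from
    [a] can be neither unreached nor smaller than [b], since steps across it are
    allowed on both sides. *)
Lemma itv_creeping (P : R -> Prop) a b : a <= b -> P a ->
    (forall t, a <= t <= b -> exists2 d, 0 < d &
       forall s s', t - d < s -> s <= t -> t <= s' -> s' < t + d ->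
         a <= s -> s' <= b -> P s -> P s') ->
  P b.
Proof.
move=> ab Pa step; pose S := [set x | a <= x <= b /\ P x].
have Sa : S a by split; rewrite ?lexx.
have Sub : ubound S b by move=> x [/andP[]].
have supS : has_sup S by split; [exists a|exists b].
have at_ : a <= sup S by apply: sup_upper_bound.
have tb : sup S <= b by apply: ge_sup => //; exists a.
have [|d d0 stepd] := step (sup S); first by rewrite at_ tb.
have [s [/andP[as_ sb] Ps] ds] := sup_adherent d0 supS.
have st : s <= sup S by apply: sup_upper_bound => //; split; rewrite ?as_.
pose s' := Num.min b (sup S + d / 2).
have ts' : sup S <= s' by rewrite le_min tb /= lerDl divr_ge0 ?ltW.
have s'd : s' < sup S + d.
  by rewrite gt_min ltrD2l ltr_pdivrMr // ltr_pMr // ltr1n orbT.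
have s'b : s' <= b by rewrite ge_min lexx.
have Ps' : P s' by apply: (stepd s).
have : s' <= sup S.
  by apply: sup_upper_bound => //; split=> //; rewrite (le_trans at_ ts').
rewrite ge_min => /orP[bt|]; last by rewrite gerDl leNgt divr_gt0.
by have <- : s' = b by apply/le_anti; rewrite s'b (le_trans bt).
Qed.

Lemma abs_continuous_on_unif a b u : abs_continuous_on a b u ->
  forall e, 0 < e -> exists2 d, 0 < d &
    forall x y, a <= x <= b -> a <= y <= b -> `|x - y| < d -> `|u x - u y| < e.
Proof.
move=> acu e e0; have [d d0 acd] := acu _ e0; exists d => // x y.
wlog xy : x y / x <= y.
  move=> wl xab yab; case/orP: (le_total x y) => [/wl|yx]; first exact.
  by rewrite distrC (distrC (u x)); exact: wl.
move=> /andP[ax xb] /andP[ay yb] xyd.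
have := acd 1%N (fun=> x) (fun=> y); rewrite !big_ord_recl !big_ord0 !addr0.
rewrite distrC; apply=> //; first by move=> i j _ _ _; rewrite !ord1.
by rewrite (le_lt_trans _ xyd)// distrC ler_norm.
Qed.

Lemma abs_continuous_onZ a b k u : abs_continuous_on a b u ->
  abs_continuous_on a b (fun t => k * u t).
Proof.
move=> acu e e0; have k0 : 0 < `|k| + 1 by rewrite ltr_wpDl.
have [|d d0 acd] := acu (e / (`|k| + 1)); first by rewrite divr_gt0.
exists d => // n x y xy triv xyd.
have := acd n x y xy triv xyd; rewrite ltr_pdivlMr //; apply: le_lt_trans.
rewrite mulr_suml ler_sum // => i _.
by rewrite -mulrBr normrM mulrC ler_wpM2l // lerDl.
Qed.

Lemma abs_continuous_onB a b u v : abs_continuous_on a b u ->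
  abs_continuous_on a b v -> abs_continuous_on a b (fun t => u t - v t).
Proof.
move=> acu acv e e0; have e20 : 0 < e / 2 by rewrite divr_gt0.
have [d d0 acd] := acu _ e20; have [d' d'0 acd'] := acv _ e20.
exists (Num.min d d'); first by rewrite lt_min d0.
move=> n x y xy triv; rewrite lt_min => /andP[xyd xyd'].
have := ltrD (acd n x y xy triv xyd) (acd' n x y xy triv xyd').
rewrite -splitr; apply: le_lt_trans.
rewrite -big_split ler_sum //= => i _.
by rewrite opprD addrACA -opprD ler_normB.
Qed.

Lemma abs_continuous_on_cst a b k : abs_continuous_on a b (cst k).
Proof.
move=> e e0; exists 1 => // n x y _ _ _.
by rewrite big1 // => i _; rewrite subrr normr0.
Qed.

Lemma null_set_open_cover (N : set R) (d : R) : mu.-negligible N -> 0 < d ->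
  exists U, [/\ open U, N `<=` U & (mu U < d%:E)%E].
Proof.
move=> [A [mA A0 NA]] d0.
have [|U [oU AU Ud]] := lebesgue_regularity_outer mA _ d0.
  by rewrite [ltLHS]A0.
exists U; split=> //; first exact: subset_trans AU.
rewrite (le_lt_trans _ Ud) // -(setDUK AU).
rewrite (le_trans (measureU2 _ _ _)) //.
- by apply: measurableD => //; exact: measurable_realfun.open_measurable.
- by rewrite setDUK // [X in (X + _)%E]A0 add0e.
Qed.

(** The interval [s, s'] has to straddle [t], which is why the slopes on the two
    sides of [t] add up to a bound on its increment. *)
Lemma derive_ge0_near u t e : derivable u t 1 -> 0 <= derive1 u t -> 0 < e ->
  exists2 d, 0 < d &
    forall s s', t - d < s -> s <= t -> t <= s' -> s' < t + d ->
      u s - e * (s' - s) <= u s'.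
Proof.
move=> du u'0 e0; have /cvgrPdist_lt /(_ e e0) := du.
rewrite -[lim _]/('D_1 u t) -derive1E => /nbhs_ballP[d /= d0 dq].
have {}dq h : h != 0 -> `|h| < d -> - e <= h^-1 * (u (h + t) - u t).
  move=> h0 hd; have /= := dq h.
  rewrite /ball /= sub0r normrN => /(_ hd h0).
  rewrite ltr_distlC => /andP[+ _]; rewrite [h *: 1]mulr1.
  by move=> /ltW; apply: le_trans; lra.
exists d => // s s' tds st ts' s'td.
have left : u s - e * (t - s) <= u t.
  have [->|sNt] := eqVneq s t; first by rewrite subrr mulr0 subr0.
  have lt_st : s - t < 0 by rewrite subr_lt0 lt_neqAle sNt.
  have std : `|s - t| < d by rewrite ltr0_norm //; lra.
  have := dq _ (ltr0_neq0 lt_st) std.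
  by rewrite subrK mulrC ler_ndivlMr //; lra.
have right : u t - e * (s' - t) <= u s'.
  have [->|s'Nt] := eqVneq s' t; first by rewrite subrr mulr0 subr0.
  have lt_ts' : 0 < s' - t by rewrite subr_gt0 lt_neqAle eq_sym s'Nt.
  have s'td' : `|s' - t| < d by rewrite gtr0_norm //; lra.
  have := dq _ (lt0r_neq0 lt_ts') s'td'.
  by rewrite subrK mulrC ler_pdivlMr //; lra.
lra.
Qed.

(** The exceptional null set is covered by an open [U] of measure less than the
    modulus [d] of absolute continuity. Moving from [a] to [b] by small steps,
    a step around a good point loses at most [k] times its length, and a step
    around a point of [U] stays in [U]; the latter steps are collected into
    a disjoint family whose total length is at most [mu U], so that their total
    loss is controlled by absolute continuity. *)
Lemma abs_continuous_derive_ge0 a b u : a <= b -> abs_continuous_on a b u ->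
    {ae mu, forall t, a < t < b -> derivable u t 1 /\ 0 <= derive1 u t} ->
  u a <= u b.
Proof.
move=> ab acu u'ge0; apply/ler_addgt0Pr => e e0.
have [d d0 acd] : exists2 d : R, 0 < d & forall (n : nat) (x y : 'I_n -> R),
    (forall i, [/\ a <= x i, x i <= y i & y i <= b]) ->
    trivIset [set: 'I_n] (fun i => [set` `]x i, y i[]) ->
    \sum_(i < n) (y i - x i) < d -> \sum_(i < n) `|u (y i) - u (x i)| < e / 2.
  by apply: acu; rewrite divr_gt0.
pose N := ~` [set t | a < t < b -> derivable u t 1 /\ 0 <= derive1 u t]
  `|` [set a] `|` [set b].
have Nnull : mu.-negligible N.
  apply: negligibleU; last first.
    by apply/negligibleP => //; exact: lebesgue_measure_set1.
  apply: negligibleU => //.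
  by apply/negligibleP => //; exact: lebesgue_measure_set1.
have [U [oU NU Ud]] := null_set_open_cover Nnull d0.
have mU : measurable U by exact: measurable_realfun.open_measurable.
(* The added 1 avoids a division by zero when a = b. *)
pose k := e / 2 / (b - a + 1).
have k0 : 0 < k by rewrite divr_gt0 ?divr_gt0 // ltr_wpDl // subr_ge0.
(* The length of the family is compared with the part of U left of x, so that
   the bound survives the addition of an interval lying in U. *)
pose P x := exists n (p q : 'I_n -> R),
  [/\ forall i, [/\ a <= p i, p i <= q i & q i <= x],
      trivIset [set: 'I_n] (fun i => [set` `]p i, q i[]),
      ((\sum_(i < n) (q i - p i))%:E <= mu (U `&` `[a, x]))%E &
      u a - k * (x - a) - \sum_(i < n) `|u (q i) - u (p i)| <= u x].
have Pb : P b.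
  apply: (@itv_creeping P a b) => //.
    exists 0%N, (fun=> 0), (fun=> 0); rewrite !big_ord0; split => //.
    - by move=> [].
    - by move=> [].
    - by rewrite subrr mulr0 !subr0.
  move=> t /andP[at_ tb]; have [tU|tNU] := pselect (U t).
    have /nbhs_ballP[r /= r0 rU] : nbhs t U by exact: open_nbhs_nbhs.
    exists r => // s s' trs st ts' s'tr as_ s'b [n [p [q [pq triv len inc]]]].
    have ss' : s <= s' by exact: le_trans ts'.
    exists n.+1, (fun i => if unlift ord0 i is Some j then p j else s),
      (fun i => if unlift ord0 i is Some j then q j else s').
    split.
    - move=> i; case: unliftP => [j _|_] //.
      by have [? ? qs] := pq j; split => //; exact: le_trans ss'.
    - move=> i j _ _.
      case: unliftP => [i' ->|->]; case: unliftP => [j' ->|->] //.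
      + by move=> /triv -> //.
      + move=> [z /= []]; rewrite !in_itv /= => /andP[_ zq] /andP[sz _].
        by have [_ _ qs] := pq i'; exfalso; lra.
      + move=> [z /= []]; rewrite !in_itv /= => /andP[sz _] /andP[_ zq].
        by have [_ _ qs] := pq j'; exfalso; lra.
    - rewrite big_ord_recl unlift_none.
      under eq_bigr do rewrite liftK.
      rewrite EFinD.
      have sub : (U `&` `[a, s]) `|` `]s, s'] `<=` U `&` `[a, s'].
        move=> z [[Uz]|] /=; rewrite !in_itv /= => /andP[z1 z2]; split => //.
        + by rewrite z1 (le_trans z2).
        + by apply: rU; rewrite /ball /= ltr_distl; lra.
        + by lra.
      have mUs : measurable (U `&` `[a, s]) by exact: measurableI.
      apply: (@le_trans _ _ (mu ((U `&` `[a, s]) `|` `]s, s']))); last first.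
        apply: le_measure; rewrite ?inE //; first exact: measurableU.
        exact: measurableI.
      rewrite measureU //; last first.
        rewrite -subset0 => z [[_ /=]]; rewrite !in_itv /=; lra.
      rewrite addeC; apply: leeD => //.
      rewrite [leRHS]lebesgue_measure_itv /= lte_fin; case: ltP => //.
      by rewrite lee_fin; lra.
    - rewrite big_ord_recl unlift_none.
      under eq_bigr do rewrite liftK.
      set S := \sum_(i < n) _ in inc *.
      have := ler_norm (- (u s' - u s)); rewrite normrN.
      have : k * (s - a) <= k * (s' - a) by apply: ler_wpM2l; [exact: ltW|lra].
      by lra.
  have [du u'0] : derivable u t 1 /\ 0 <= derive1 u t.
    apply: contrapT => nd; apply: tNU; apply: NU.
    have [->|ta] := eqVneq t a; first by left; right.
    have [->|tNb] := eqVneq t b; first by right.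
    left; left => /= /(_ _); apply: contra_not nd; apply.
    by rewrite !lt_neqAle at_ tb eq_sym ta tNb.
  have [r r0 near_t] := derive_ge0_near du u'0 k0.
  exists r => // s s' trs st ts' s'tr as_ s'b [n [p [q [pq triv len inc]]]].
  exists n, p, q; split => //.
  - by move=> i; have [? ? qs] := pq i; split => //; lra.
  - apply: (le_trans len); apply: le_measure; rewrite ?inE //.
    + by exact: measurableI.
    + by exact: measurableI.
    + apply: setIS => z /=; rewrite !in_itv /=; lra.
  - by have := near_t s s' trs st ts' s'tr; lra.
have [n [p [q [pq triv len inc]]]] := Pb.
have lend : \sum_(i < n) (q i - p i) < d.
  rewrite -lte_fin (le_lt_trans len) // (le_lt_trans _ Ud) //.
  by apply: le_measure; rewrite ?inE //; exact: measurableI.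
have := acd n p q pq triv lend.
have : k * (b - a) <= e / 2.
  rewrite /k mulrAC ler_pdivrMr; last by lra.
  by nra.
by lra.
Qed.

End absolute_continuity.

Section fundamental_theorem.
Context {R : realType}.
Local Notation mu := (@lebesgue_measure R).
Implicit Types (u v g : R -> R) (a b : R).

(** Absolute continuity of the integral with respect to the measure, applied to
    the union of the given intervals. *)
Lemma abs_continuous_primitive a b g : mu.-integrable setT (EFin \o g) ->
  abs_continuous_on a b (fun x => \int[mu]_(t in `[a, x]) g t).
Proof.
move=> ig e e0; have [d [d0 gd]] := integral_normr_continuous ig e0.
exists d => // n x y xy triv xyd.
have trivF : trivIset [set: 'I_n] (fun i => [set` `]x i, y i]]).
  apply/trivIsetP => i j _ _ ij; rewrite -subset0 => z [] /=.
  rewrite !in_itv /= => /andP[xiz zyi] /andP[xjz zyj].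
  (* Two of the half-open intervals that share z also share the points just
     below z, and these are interior to both. *)
  pose w := Num.max (x i) (x j).
  have wz : (w + z) / 2 < z.
    have : w < z by rewrite gt_max xiz.
    by lra.
  have ww : w < (w + z) / 2.
    have : w < z by rewrite gt_max xiz.
    by lra.
  move/eqP: ij; apply; apply: triv => //; exists ((w + z) / 2).
  have : x i <= w by rewrite le_max lexx.
  have : x j <= w by rewrite le_max lexx orbT.
  by split; rewrite /= in_itv /=; lra.
pose A := \big[setU/set0]_(i < n) [set` `]x i, y i]].
have mA : measurable A by apply: bigsetU_measurable.
have muA : mu A = (\sum_(i < n) (y i - x i))%:E.
  rewrite /A measure_semi_additive_ord // -sumEFin; apply: eq_bigr => i _.
  rewrite [LHS]lebesgue_measure_itv /= lte_fin; have [_ xyi _] := xy i.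
  by case: ltgtP xyi => // -> _; rewrite subrr.
have := gd A mA; rewrite [X in (X < _)%E]muA lte_fin => /(_ xyd).
apply: le_lt_trans.
have ign : mu.-integrable setT (EFin \o (fun t => `|g t|)).
  exact: (integrable_abse ig).
have intA : (\int[mu]_(t in A) `|g t|%:E =
    \sum_(i < n) \int[mu]_(t in `]x i, y i]) `|g t|%:E)%E.
  have := (@integral_bigsetU_EFin _ _ _ mu _
    (fun i => [set` `]x i, y i]]) (fun t => `|g t|) (index_enum 'I_n)).
  apply => //.
  - exact: index_enum_uniq.
  - by apply: sub_trivIset trivF.
  - by apply: (measurable_int mu); exact: integrableS ign.
rewrite [leRHS]/Rintegral intA -sum_fine; last first.
  by move=> i _; apply: integrable_fin_num => //; exact: integrableS ign.
apply: ler_sum => i _; have [axi xyi _] := xy i.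
rewrite Rintegral_itvB ?bnd_simp //; last by exact: integrableS ig.
by apply: le_normr_Rintegral => //; exact: integrableS ig.
Qed.

(** By Lebesgue differentiation [u] minus the primitive of [g] has almost
    everywhere nonnegative derivative. *)
Lemma integral_le_increment a b u g : a <= b -> abs_continuous_on a b u ->
    mu.-integrable `[a, b] (EFin \o g) ->
    {ae mu, forall t, a < t < b -> derivable u t 1 /\ g t <= derive1 u t} ->
  \int[mu]_(t in `[a, b]) g t <= u b - u a.
Proof.
move=> ab acu ig u'ge.
(* Extending g by zero makes it integrable on every interval [a, y], as FTC1
   asks, and keeps its integral over [a, b]. *)
pose h := g \_ `[a, b].
have ih : mu.-integrable setT (EFin \o h).
  by move: ig; rewrite integrable_mkcond // restrict_EFin.
pose G x := \int[mu]_(t in `[a, x]) h t.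
have acG : abs_continuous_on a b G by exact: abs_continuous_primitive.
have G' : {ae mu, forall t, a < t -> derivable G t 1 /\ derive1 G t = h t}.
  have := @FTC1 R h (BLeft a); apply.
    by move=> y; exact: integrableS ih.
  by apply: open_integrable_locally; [exact: openT|].
have : u a - G a <= u b - G b.
  apply: (abs_continuous_derive_ge0 ab (abs_continuous_onB acu acG)).
  apply: filterS2 u'ge G' => t u't G't /andP[at_ tb].
  have [du gu] : derivable u t 1 /\ g t <= derive1 u t.
    by apply: u't; rewrite at_.
  have [dG hG] := G't at_.
  split; first exact: derivableB.
  rewrite derive1E (deriveB du dG) -!derive1E hG /h patchE mem_set ?subr_ge0 //.
  by rewrite /= in_itv /= !ltW.
have -> : G a = 0 by rewrite /G set_itv1 Rintegral_set1.
have -> : G b = \int[mu]_(t in `[a, b]) g t.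
  by apply: eq_Rintegral => t tab; rewrite /h patchE tab.
by lra.
Qed.

Lemma locally_integrable_itv g a b : locally_integrable [set: R] g ->
  mu.-integrable `[a, b] (EFin \o g).
Proof.
move=> [mg _ ig]; apply/integrableP; split.
  by apply/measurable_realfun.measurable_EFinP; exact: measurable_funTS.
by have := ig [set` `[a, b]] (@subsetT _ _) (@segment_compact _ a b).
Qed.

End fundamental_theorem.

(** * Functions on a left half-line *)

Section extension.
Context {R : realType}.
Local Notation mu := (@lebesgue_measure R).
Implicit Types (u v g : R -> R) (a b : R).

(** For [b' < a] there are no intervals to test, so [a] and [b'] need not be
    ordered. *)
Definition left_abs_continuous b u : Prop :=
  forall a b', b' <= b -> abs_continuous_on a b' u.

Lemma ACloc_left b D u : ACloc `]-oo, b] D u -> left_abs_continuous b u.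
Proof.
move=> [_ acu] a b' b'b; have [ab'|b'a] := leP a b'.
  apply: acu => // x /=; rewrite !in_itv /= => /andP[_ xb'].
  exact: le_trans b'b.
move=> e e0; exists 1 => // n x y xy _ _.
rewrite big1 // => i _; have [axi xyi yib] := xy i.
by have := lt_le_trans b'a (le_trans axi (le_trans xyi yib)); rewrite ltxx.
Qed.

Lemma extend_constE b u t : t <= b -> extend_const b u t = u t.
Proof. by move=> tb; rewrite /extend_const min_l. Qed.

Lemma abs_continuous_extend_const b u :
  left_abs_continuous b u -> left_abs_continuous b (extend_const b u).
Proof.
move=> acu a b' b'b e e0; have [d d0 acd] := acu a b' b'b e e0.
exists d => // n x y xy triv xyd.
rewrite (le_lt_trans _ (acd n x y xy triv xyd)) //.
apply: ler_sum => i _; have [axi xyi yib] := xy i.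
have yb := le_trans yib b'b.
have xb := le_trans xyi yb.
by rewrite !extend_constE.
Qed.

Lemma continuous_extend_const b u :
  left_abs_continuous b u -> continuous (extend_const b u).
Proof.
move=> acu x; apply/cvgrPdist_lt => e e0.
pose a := Num.min x b - 1.
have [d d0 unif] := abs_continuous_on_unif (acu a b (lexx b)) e0.
apply/nbhs_ballP; exists (Num.min d 1) => /=; first by rewrite lt_min d0 ltr01.
move=> y; rewrite /ball /= lt_min => /andP[yd y1].
have minxy : `|Num.min x b - Num.min y b| <= `|x - y|.
  rewrite ler_norml /Num.min; have := ler_norm (x - y).
  have := ler_norm (- (x - y)); rewrite normrN.
  by case: ltP => xb; case: ltP => yb; move=> ? ?; apply/andP; split; lra.
apply: unif.
- by rewrite ge_min lexx orbT andbT /a; lra.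
- rewrite [in X in _ && X]ge_min lexx orbT andbT /a.
  by have := ler_norm (Num.min x b - Num.min y b); lra.
- exact: le_lt_trans yd.
Qed.

Lemma extend_const_near b u t : t < b -> {near t, u =1 extend_const b u}.
Proof.
move=> tb; have := lt_nbhsl tb; apply: filterS => s sb.
by rewrite extend_constE // ltW.
Qed.

Lemma derivable_extend_const b u t : t < b -> derivable u t 1 ->
  derivable (extend_const b u) t 1.
Proof. move=> tb; exact: near_eq_derivable (extend_const_near u tb). Qed.

Lemma derive_extend_const b u t : t < b ->
  derive1 (extend_const b u) t = derive1 u t.
Proof.
by move=> tb; rewrite !derive1E -(near_eq_derive _ (extend_const_near u tb)).
Qed.

Lemma left_nonincreasing b u : left_abs_continuous b u ->
    {ae mu, forall t, t < b -> derivable u t 1 /\ derive1 u t <= 0} ->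
  forall s t, s <= t -> t <= b -> u t <= u s.
Proof.
move=> acu u'le0 s t st tb.
have := @abs_continuous_derive_ge0 R s t (fun x => cst 0 x - u x) st.
rewrite !sub0r lerN2; apply.
  by apply: abs_continuous_onB; [exact: abs_continuous_on_cst|exact: acu].
apply: filterS u'le0 => x u'x /andP[sx xt].
have [du u'0] := u'x (lt_le_trans xt tb).
have dc : derivable (cst (0 : R) : R -> R) x 1 by exact: derivable_cst.
split; first exact: (derivableB dc du).
by rewrite derive1E (deriveB dc du) -!derive1E derive1_cst sub0r oppr_ge0.
Qed.

End extension.

(** * Positive linear Volterra operators *)

Section operators.
Context {R : realType}.
Local Notation mu := (@lebesgue_measure R).
Implicit Types (u v w : R -> R) (T : (R -> R) -> (R -> R)).

(** Linearity is stated for [a u + v], so differences are reached by comparing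
    the two decompositions of [a u] as [1 (a u - v) + v] and [a u + 0]. *)
Lemma linear_operator_scaleB T a u v : linear_operator T ->
    continuous u -> continuous v ->
  {ae mu, forall t, T (fun s => a * u s - v s) t = a * T u t - T v t}.
Proof.
move=> linT cu cv.
have c0 : continuous (cst 0 : R -> R) by move=> x; exact: cvg_cst.
have cw : continuous (fun s => a * u s - v s).
  by move=> x; apply: cvgB; [apply: cvgM; [exact: cvg_cst|exact: cu]|exact: cv].
have T0 := linT 1 _ _ c0 c0.
have Tau := linT a _ _ cu c0.
have TB := linT 1 _ _ cw cv.
have E0 : (fun s : R => 1 * cst 0 s + cst 0 s) = cst (0 : R).
  by apply/funext => s; rewrite /cst mulr0 addr0.
have E1 : (fun s => 1 * (a * u s - v s) + v s) =
    (fun s => a * u s + cst 0 s).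
  by apply/funext => s; rewrite /cst mul1r addrNK addr0.
rewrite E0 in T0; rewrite E1 in TB.
by apply: filterS3 T0 Tau TB => t; lra.
Qed.

(** Positivity concerns functions that are nonnegative on the whole line; the
    Volterra property allows [w] to be replaced by its constant continuation to
    the right of [zeta]. *)
Lemma Volterra_ge0 T tau zeta w : Volterra tau T -> positive_operator T ->
    zeta <= tau -> continuous w -> (forall t, t <= zeta -> 0 <= w t) ->
  {ae mu, forall t, t <= zeta -> 0 <= T w t}.
Proof.
move=> [_ volT] posT zt cw w0.
have ce : continuous (extend_const zeta w).
  move=> x; apply: (@continuous_comp _ _ _ (fun t => Num.min t zeta) w).
    by apply: continuous_min; [exact: cvg_id|exact: cvg_cst].
  exact: cw.
have ew t : t <= zeta -> w t = extend_const zeta w t.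
  by move=> tz; rewrite extend_constE.
have e0 t : 0 <= extend_const zeta w t by apply: w0; rewrite ge_min lexx orbT.
apply: filterS2 (volT _ zt _ _ cw ce ew) (posT _ ce e0) => t eqT Te tz.
by rewrite eqT.
Qed.

(** If [v] were positive somewhere, [lam = sup v / g] would be positive, and
    [w = lam g - v] nonnegative with [w' <= - T w <= 0], hence at least
    [eta = w ts = lam g(ts) > 0]. From [v <= lam g - eta] and [v <= kappa],
    weighted by [kappa] and [eta], follows [(kappa + eta) v <= kappa lam g],
    which contradicts the choice of [lam]. *)
Lemma supersolution_vanishes_before_zero T (t0 ts kappa : R) (g v : R -> R) :
    linear_operator T -> positive_operator T -> Volterra t0 T -> ts <= t0 ->
    continuous g -> left_abs_continuous t0 g ->
    (forall t, t <= t0 -> 0 < g t) ->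
    {ae mu, forall t, t < t0 -> derivable g t 1 /\ derive1 g t <= - T g t} ->
    continuous v -> left_abs_continuous ts v ->
    (forall t, t <= ts -> 0 <= v t <= kappa) -> v ts = 0 ->
    {ae mu, forall t, t < ts -> derivable v t 1 /\ - T v t <= derive1 v t} ->
  forall t, t <= ts -> v t = 0.
Proof.
move=> linT posT volT tst0 cg acg g0 g' cv acv v0 vts v' t tts.
have gn s : s <= ts -> g ts <= g s.
  move=> sts; apply: (left_nonincreasing acg) => //.
  have Tg0 : {ae mu, forall t, t <= t0 -> 0 <= T g t}.
    by apply: (Volterra_ge0 volT posT) => // x /g0/ltW.
  apply: filterS2 g' Tg0 => x gx Tgx xt0; have [dg] := gx xt0.
  by have := Tgx (ltW xt0); split=> //; lra.
have gts := g0 _ tst0.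
apply/eqP; rewrite eq_le; have /andP[-> vk] := v0 _ tts; rewrite andbT leNgt.
apply/negP => vt.
have kappa0 : 0 < kappa by exact: lt_le_trans vk.
have gpos s : s <= ts -> 0 < g s by move=> sts; apply: g0; exact: le_trans tst0.
pose S := [set v s / g s | s in [set s | s <= ts]].
have Svt : S (v t / g t) by exists t.
have ubS m : 0 < m -> (forall s, s <= ts -> v s <= m * g s) -> ubound S m.
  by move=> m0 vm x [s /= sts <-]; rewrite ler_pdivrMr ?gpos // vm.
have supS : has_sup S.
  split; first by exists (v t / g t).
  exists (kappa / g ts); apply: ubS; first by rewrite divr_gt0.
  move=> s sts; have /andP[_ /le_trans] := v0 _ sts; apply.
  by rewrite mulrAC ler_pdivlMr // ler_wpM2l ?gn // ltW.
pose lam := sup S.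
have lam0 : 0 < lam.
  apply: (@lt_le_trans _ _ (v t / g t)); first by rewrite divr_gt0 ?gpos.
  exact: sup_upper_bound.
have vlam s : s <= ts -> v s <= lam * g s.
  move=> sts; rewrite -ler_pdivrMr ?gpos //; apply: sup_upper_bound => //.
  by exists s.
pose w s := lam * g s - v s.
have cw : continuous w.
  by move=> x; apply: cvgB; [apply: cvgM; [exact: cvg_cst|exact: cg]|exact: cv].
have Tw0 : {ae mu, forall s, s <= ts -> 0 <= T w s}.
  by apply: (Volterra_ge0 volT posT) => // s /vlam; rewrite /w subr_ge0.
have w'le0 : {ae mu, forall s, s < ts -> derivable w s 1 /\ derive1 w s <= 0}.
  have Tw := linear_operator_scaleB lam linT cg cv.
  apply: filterS2 (filterI g' v') (filterI Tw0 Tw) => s.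
  move=> [g's v's] [Tw0s Tws] sts.
  have [dg g'le] := g's (lt_le_trans sts tst0); have [dv v'ge] := v's sts.
  have dlg : derivable (fun x => lam * g x) s 1 by exact: derivableZ.
  split; first exact: (derivableB dlg dv).
  rewrite derive1E (deriveB dlg dv) -!derive1E derive1Ml //.
  have := Tw0s (ltW sts); rewrite Tws.
  have : lam * derive1 g s <= lam * (- T g s) by rewrite ler_pM2l.
  by lra.
have acw : left_abs_continuous ts w.
  move=> a b bts; apply: abs_continuous_onB (acv _ _ bts).
  by apply: abs_continuous_onZ; apply: acg; exact: le_trans tst0.
have wts s : s <= ts -> lam * g ts <= w s.
  move=> sts; have := left_nonincreasing acw w'le0 sts (lexx _).
  by rewrite {1}/w vts subr0.
pose eta := lam * g ts.
have eta0 : 0 < eta by rewrite mulr_gt0.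
have : lam <= lam * kappa / (kappa + eta).
  apply: ge_sup; first by exists (v t / g t).
  apply: ubS; first by rewrite divr_gt0 ?mulr_gt0 // addr_gt0.
  move=> s sts; rewrite mulrAC ler_pdivlMr ?addr_gt0 //.
  have /andP[_ vk'] := v0 _ sts; have := wts _ sts; rewrite -/eta /w.
  by nra.
rewrite ler_pdivlMr ?addr_gt0 // ler_pM2l //; lra.
Qed.

End operators.

(** * Limits superior at minus infinity *)

Section limits.
Context {R : realType}.

Lemma limf_esup_gt0_frequently (F : R -> \bar R) :
    (0 < limf_esup F (-oo)%R)%E ->
  exists2 q : R, 0 < q & forall A : R, exists2 t, t < A & (q%:E < F t)%E.
Proof.
rewrite limf_esupE; set l := ereal_inf _ => l0.
have [q q0 ql] : exists2 q : R, 0 < q & (q%:E < l)%E.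
  case: l l0 => [r|_|//]; last by exists 1; rewrite ?ltry.
  by rewrite lte_fin => r0; exists (r / 2); rewrite ?lte_fin; lra.
exists q => // A; have : (q%:E < ereal_sup (F @` [set t : R | (t < A)%R]))%E.
  apply: (lt_le_trans ql); apply: ereal_inf_lbound.
  by exists [set t : R | t < A] => //; exists A; split=> //; exact: num_real.
by move=> /ereal_sup_gt[_ [t /= tA <-] qt]; exists t.
Qed.

Lemma ereal_sup_lty_bounded (S : set (\bar R)) : (ereal_sup S < +oo)%E ->
  exists2 M : R, 0 <= M & forall x, S x -> (x <= M%:E)%E.
Proof.
move=> Sy; have ub x : S x -> (x <= ereal_sup S)%E by exact: ereal_sup_ubound.
case E : (ereal_sup S) Sy ub => [r|//|] _ ub.
  exists (Num.max 0 r); first by rewrite le_max lexx.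
  by move=> x /ub /le_trans; apply; rewrite lee_fin le_max lexx orbT.
by exists 0 => // x /ub /le_trans; apply; exact: leNye.
Qed.

End limits.

(** * Solutions with values in [0, kappa] *)

Section nonneg_solution.
Context {R : realType}.
Local Notation mu := (@lebesgue_measure R).
Variables (l0 l1 F : (R -> R) -> (R -> R)) (t0 kappa L : R) (g u : R -> R).
Hypotheses (l0_lin : linear_operator l0) (l0_pos : positive_operator l0).
Hypotheses (l1_lin : linear_operator l1) (l1_pos : positive_operator l1).
Hypothesis l1_V : Volterra t0 l1.
Hypothesis l01 : {ae mu, forall t, t <= t0 -> l1 (cst 1) t <= l0 (cst 1) t}.
Hypotheses (g_cont : continuous g) (g_ac : left_abs_continuous t0 g).
Hypothesis g_gt0 : forall t, t <= t0 -> 0 < g t.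
Hypothesis g' : {ae mu, forall t, t < t0 ->
  derivable g t 1 /\ derive1 g t <= - l1 g t}.
Hypotheses (u_cont : continuous u) (u_ac : left_abs_continuous t0 u).
Hypothesis u_bnd : forall t, 0 <= u t <= kappa.
Hypothesis u_cst : forall t, t0 <= t -> u t = u t0.
Hypothesis u_lim : u t @[t --> -oo] --> L.
Hypothesis Fu_ge0 : {ae mu, forall t, t <= t0 -> 0 <= F u t}.
Hypothesis u' : {ae mu, forall t, t < t0 ->
  derivable u t 1 /\ derive1 u t = l0 u t - l1 u t + F u t}.

(** Subtract [d] times the values at the constant 1; [l0 (u - d) >= 0]. *)
Lemma derive_subr_cst_ge d : 0 <= d -> (forall t, d <= u t) ->
  {ae mu, forall t, t < t0 -> derivable (fun s => u s - d) t 1 /\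
    - l1 (fun s => u s - d) t + d * (l0 (cst 1) t - l1 (cst 1) t) + F u t
      <= derive1 (fun s => u s - d) t}.
Proof.
move=> d0 du; set v := fun s => u s - d.
have c1 : continuous (cst 1 : R -> R) by move=> x; exact: cvg_cst.
have cv : continuous v.
  by move=> x; apply: cvgB; [exact: u_cont|exact: cvg_cst].
have uE : (fun s => d * cst 1 s + v s) = u.
  by apply/funext => s; rewrite /v /cst mulr1 addrC addrNK.
have := l0_lin d c1 cv; have := l1_lin d c1 cv; rewrite uE => l1u l0u.
have l0v : {ae mu, forall t, 0 <= l0 v t}.
  by apply: l0_pos => // t; rewrite subr_ge0.
apply: filterS2 (filterI u' l0v) (filterI l1u l0u) => t.
move=> [u't l0vt] [l1ut l0ut] tt0; have [dut u'E] := u't tt0.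
have dc : derivable (cst d : R -> R) t 1 by exact: derivable_cst.
split; first exact: (derivableB dut dc).
rewrite derive1E (deriveB dut dc) -!derive1E derive1_cst subr0 u'E.
by rewrite l1ut l0ut; lra.
Qed.

(** [u - d] is a nonnegative supersolution of [v' = - l1 v] with a zero at
    [ts]. *)
Lemma constant_before_minimum d ts : ts <= t0 -> (forall t, d <= u t) ->
  u ts = d -> forall t, t <= ts -> u t = d.
Proof.
move=> tst0 du uts t tts.
have d0 : 0 <= d by rewrite -uts; case/andP: (u_bnd ts).
apply/eqP; rewrite -subr_eq0; apply/eqP.
apply: (supersolution_vanishes_before_zero
  (v := fun s => u s - d) (kappa := kappa)
  l1_lin l1_pos l1_V tst0 g_cont g_ac g_gt0 g') => //.
- by move=> x; apply: cvgB; [exact: u_cont|exact: cvg_cst].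
- move=> a b bts; apply: (@abs_continuous_onB _ _ _ u (cst d)).
    by apply: u_ac; exact: le_trans tst0.
  exact: abs_continuous_on_cst.
- move=> s _; rewrite subr_ge0 du /=.
  by have /andP[_ uk] := u_bnd s; lra.
- by rewrite uts subrr.
- apply: filterS3 (derive_subr_cst_ge d0 du) l01 Fu_ge0 => s vs l01s Fs sts.
  have st0 := lt_le_trans sts tst0; have [dv v'] := vs st0.
  split => //; apply: le_trans v'; have := Fs (ltW st0).
  have : 0 <= d * (l0 (cst 1) s - l1 (cst 1) s).
    by rewrite mulr_ge0 // subr_ge0 l01s // ltW.
  by lra.
Qed.

(** If [u] took a value below its limit at [-oo], its minimum would be attained,
    and [u] would equal that minimum from there back to [-oo]. *)
Lemma limit_at_ninfty_le t : L <= u t.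
Proof.
wlog tt0 : t / t <= t0.
  move=> wl; have [/wl//|t0t] := leP t t0.
  by rewrite (u_cst (ltW t0t)); exact: wl.
rewrite leNgt; apply/negP => utL.
have [M [_ Mu]] : \forall x \near -oo, u t < u x by exact: (cvgr_gt _ u_lim).
(* Left of a, the values of u exceed u t, so its minimum over [a, t0] is the
   global one. *)
pose a := Num.min M t - 1.
have aM : a < M.
  by rewrite /a ltrBlDr gt_min ltrDl ltr01.
have at_ : a <= t.
  by rewrite /a lerBlDr ge_min [in X in _ || X]lerDl ler01 orbT.
have at0 : a <= t0 by exact: le_trans tt0.
have [|ts] := @EVT_min R u a t0 at0.
  by apply: continuous_subspaceT.
rewrite in_itv /= => /andP[ats tst0] tsmin.
have utst : u ts <= u t by apply: tsmin; rewrite in_itv /= at_.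
have du x : u ts <= u x.
  have [xt0|/ltW t0x] := leP x t0; last first.
    by rewrite (u_cst t0x) tsmin // in_itv /= at0 lexx.
  have [ax|xa] := leP a x; first by rewrite tsmin // in_itv /= ax.
  by rewrite (le_trans utst) // ltW // Mu // (lt_trans xa).
have ucst := constant_before_minimum tst0 du erefl.
have : L = u ts.
  apply: (cvg_unique _ u_lim) => //; apply: cvg_near_cst.
  by exists ts; split=> [|x /ltW /ucst]; first exact: num_real.
by move=> LE; move: utL; rewrite LE ltNge utst.
Qed.

Lemma limit_at_ninfty_ge0 : 0 <= L.
Proof.
rewrite leNgt; apply/negP => L0.
have [M [_ Mu]] : \forall x \near -oo, u x < 0 by exact: (cvgr_lt _ u_lim).
have /Mu : M - 1 < M by rewrite ltrBlDr ltrDl.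
by have /andP[u0 _] := u_bnd (M - 1); rewrite ltNge u0.
Qed.

(** Far to the left [0 <= u - L <= e], so the increments of [u - L] and the
    integrals of [l1 (u - L)] are small; as [k X - e l1 1 <= (u - L)'] there,
    the integrals of [X] over [omega t, t] cannot exceed [q] arbitrarily far to
    the left. *)
Lemma dominated_integrals_not_frequently_large (omega X : R -> R) (k M q : R) :
    Lloc_valued l1 -> locally_integrable [set: R] X ->
    (forall t, omega t <= t) -> 0 <= M ->
    (forall t, t <= t0 -> (\int[mu]_(s in `[omega t, t]) (l1 (cst 1) s)%:E
                             <= M%:E)%E) ->
    0 < k -> 0 < q ->
    (forall A, exists2 t, t < A &
       (q%:E < \int[mu]_(s in `[omega t, t]) (X s)%:E)%E) ->
    {ae mu, forall t, t <= t0 ->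
       k * X t <= L * (l0 (cst 1) t - l1 (cst 1) t) + F u t} ->
  False.
Proof.
move=> l1_loc X_loc omega_le M0 l1M k0 q0 Xq kX.
(* With this e, increment and delay terms add up to e (1 + M) < k q. *)
pose e := k * q / 2 / (1 + M).
have M10 : 0 < 1 + M by rewrite ltr_wpDr.
have kq0 : 0 < k * q by rewrite mulr_gt0.
have e0 : 0 < e by rewrite divr_gt0 // divr_gt0.
have eE : e * (1 + M) = k * q / 2 by rewrite /e divfK // gt_eqF.
have [A [_ uA]] : \forall x \near -oo, u x < L + e.
  by apply: (cvgr_lt _ u_lim); rewrite ltrDl.
have [t tA qt] := Xq (Num.min A t0).
move: tA; rewrite lt_min => /andP[tA tt0].
have c1 : continuous (cst 1 : R -> R) by move=> x; exact: cvg_cst.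
pose v s := u s - L.
have cv : continuous v.
  by move=> x; apply: cvgB; [exact: u_cont|exact: cvg_cst].
have l1w : {ae mu, forall s, s <= t -> l1 v s <= e * l1 (cst 1) s}.
  have cw : continuous (fun s => e * cst 1 s - v s).
    move=> x; apply: cvgB; last exact: cv.
    by apply: cvgM; exact: cvg_cst.
  have w0 : forall s, s <= t -> 0 <= e * cst 1 s - v s.
    move=> s st; rewrite /cst mulr1 subr_ge0 /v.
    by have := uA s (le_lt_trans st tA); lra.
  apply: filterS2 (Volterra_ge0 l1_V l1_pos (ltW tt0) cw w0)
    (linear_operator_scaleB e l1_lin c1 cv) => s ws wE st.
  by have := ws st; rewrite wE; lra.
have il1 := locally_integrable_itv (omega t) t (l1_loc _ c1).
have iX := locally_integrable_itv (omega t) t X_loc.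
have ikX : mu.-integrable `[omega t, t] (EFin \o (fun s => k * X s)).
  exact: (integrableZl _ k iX).
have iel1 : mu.-integrable `[omega t, t] (EFin \o (fun s => e * l1 (cst 1) s)).
  exact: (integrableZl _ e il1).
have : \int[mu]_(s in `[omega t, t]) (k * X s - e * l1 (cst 1) s)
    <= v t - v (omega t).
  apply: integral_le_increment => //.
  - apply: (@abs_continuous_onB _ _ _ u (cst L)).
      by apply: u_ac; exact: ltW.
    exact: abs_continuous_on_cst.
  - exact: (integrableB _ ikX iel1).
  - apply: filterS3 (derive_subr_cst_ge limit_at_ninfty_ge0 limit_at_ninfty_le)
      l1w kX => s vs l1s kXs /andP[_ st].
    have st0 := lt_trans st tt0; have [dv v'] := vs st0; split => //.
    by have := l1s (ltW st); have := kXs (ltW st0); rewrite /v; lra.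
rewrite RintegralB // !RintegralZl //.
have : q < \int[mu]_(s in `[omega t, t]) X s.
  by rewrite -lte_fin /Rintegral fineK //; exact: integrable_fin_num.
have : \int[mu]_(s in `[omega t, t]) l1 (cst 1) s <= M.
  rewrite -lee_fin /Rintegral fineK; last exact: integrable_fin_num.
  by apply: l1M; exact: ltW.
set I1 := \int[mu]_(s in _) l1 _ _; set I2 := \int[mu]_(s in _) X s => I1M qI2.
have := limit_at_ninfty_le (omega t); have := uA t tA; rewrite /v.
have : e * I1 <= e * M by rewrite ler_pM2l.
have : k * q < k * I2 by rewrite ltr_pM2l.
by lra.
Qed.

End nonneg_solution.

(** * The limit at minus infinity vanishes *)

Unset Implicit Arguments.

Theorem theorem2p10 (R : realType) (l0 l1 f : (R -> R) -> (R -> R))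
    (l0_cont : continuous_operator l0) (l0_lin : linear_operator l0)
    (l0_pos : positive_operator l0)
    (l1_cont : continuous_operator l1) (l1_lin : linear_operator l1)
    (l1_pos : positive_operator l1)
    (f_cont : continuous_operator f) (f_car : local_caratheodory f)
    (t0 : R)
    (l0_V : Volterra t0 l0) (l1_V : Volterra t0 l1)
    (l01 : {ae (@lebesgue_measure R), forall t, t <= t0 ->
              l1 (cst 1) t <= l0 (cst 1) t})
    (kappa : R) (kappa_gt0 : 0 < kappa)
    (f_ge0 : forall v : R -> R, C0 `[0, kappa] v ->
       {ae (@lebesgue_measure R), forall t, t <= t0 -> 0 <= f v t})
    (gamma_ex : exists2 gamma : R -> R,
       ACloc `]-oo, t0] `]0, +oo[ gamma &
       {ae (@lebesgue_measure R), forall t, t <= t0 ->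
          derivable gamma t 1 /\
          derive1 gamma t <= - l1 (extend_const t0 gamma) t})
    (c : R) (c_gt0 : 0 < c) (c_lt_kappa : c < kappa)
    (u : R -> R) (u_sol : solution l0 l1 f t0 u) (u_t0 : u t0 = c)
    (u_bnd : forall t, t <= t0 -> 0 <= u t <= kappa)
    (uninf : R) (u_lim : u t @[t --> -oo] --> uninf)
    (omega_ex : exists omega : R -> R,
       [/\ Sigma omega,
           (ereal_sup [set \int[@lebesgue_measure R]_(s in `[omega t, t])
                             (l1 (cst 1) s)%:E | t in `]-oo, t0]] < +oo)%E &
           (0 < limf_esup
                  (fun t => \int[@lebesgue_measure R]_(s in `[omega t, t])
                              (l0 (cst 1) s - l1 (cst 1) s)%:E) (-oo)%R)%E
           \/ Oclass t0 omega kappa c f]) :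
  uninf = 0.
Proof.
have [gamma acgamma gamma'] := gamma_ex; have [acu u'] := u_sol.
(* Almost everywhere statements concern t < t0 only: at t0 itself the constant
   continuation need not be differentiable. *)
pose g := extend_const t0 gamma; pose w := extend_const t0 u.
have g_ac := ACloc_left acgamma; have u_ac := ACloc_left acu.
have g_gt0 t : t <= t0 -> 0 < g t.
  move=> tt0; rewrite /g extend_constE //; have [+ _] := acgamma.
  by move=> /(_ t); rewrite /= !in_itv /= andbT; exact.
have g' : {ae (@lebesgue_measure R), forall t, t < t0 ->
    derivable g t 1 /\ derive1 g t <= - l1 g t}.
  apply: filterS gamma' => t gt tt0; have [dg g't] := gt (ltW tt0).
  by rewrite derive_extend_const //; split=> //; exact: derivable_extend_const.
have w_cont : continuous w by exact: continuous_extend_const.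
have w_bnd t : 0 <= w t <= kappa by apply: u_bnd; rewrite ge_min lexx orbT.
have w_cst t : t0 <= t -> w t = w t0.
  by move=> t0t; rewrite /w /extend_const min_r // min_l.
have w_lim : w t @[t --> -oo] --> uninf.
  apply: cvg_trans u_lim; apply: near_eq_cvg.
  exists t0; split=> [|t /ltW tt0]; first exact: num_real.
  by rewrite /w extend_constE.
have w_C0 : C0 `[0, kappa] w.
  split=> [//||t]; last by rewrite /= in_itv /=.
  exists kappa; split=> [|y ky t _]; first exact: num_real.
  have /andP[w_ge0 w_le] := w_bnd t.
  by rewrite /= ger0_norm // (le_trans w_le) // ltW.
have fw_ge0 := f_ge0 _ w_C0.
have w' : {ae (@lebesgue_measure R), forall t, t < t0 ->
    derivable w t 1 /\ derive1 w t = l0 w t - l1 w t + f w t}.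
  apply: filterS u' => t ut tt0; have [du u't] := ut (ltW tt0).
  by rewrite derive_extend_const //; split=> //; exact: derivable_extend_const.
have g_cont : continuous g by exact: continuous_extend_const.
have gac := abs_continuous_extend_const g_ac.
have wac := abs_continuous_extend_const u_ac.
have L0 := limit_at_ninfty_ge0 w_bnd w_lim.
have Lw := limit_at_ninfty_le l0_lin l0_pos l1_lin l1_pos l1_V l01 g_cont gac
  g_gt0 g' w_cont wac w_bnd w_cst w_lim fw_ge0 w'.
have wt0 : w t0 = c by rewrite /w extend_constE.
apply/eqP; rewrite eq_le L0 andbT leNgt; apply/negP => L_gt0.
have [omega [[omega_cont omega_le] /ereal_sup_lty_bounded[M M0 l1M] alt]] :=
  omega_ex.
have contradiction X k q := dominated_integrals_not_frequently_large
  (X := X) (k := k) (q := q) (M := M) (omega := omega)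
  l0_lin l0_pos l1_lin l1_pos l1_V l01 g_cont gac g_gt0 g'
  w_cont wac w_bnd w_cst w_lim fw_ge0 w' l1_cont.1.
have l1M' t : t <= t0 -> (\int[lebesgue_measure]_(s in `[omega t, t])
    (l1 (cst 1) s)%:E <= M%:E)%E.
  by move=> tt0; apply: l1M; exists t => //=; rewrite in_itv.
have c1 : continuous (cst 1 : R -> R) by move=> x; exact: cvg_cst.
case: alt => [/limf_esup_gt0_frequently[q q0 qX]|[f_loc f_O]].
  apply: (contradiction _ uninf q _ omega_le M0 l1M' L_gt0 q0 qX).
    by apply: locally_integrableB; [exact: l0_cont.1|exact: l1_cont.1].
  by apply: filterS fw_ge0 => t ft /ft; rewrite lerDl.
have Lc : uninf <= c by rewrite -wt0.
have : (0 < limf_esup (fun t => \int[lebesgue_measure]_(s in `[omega t, t])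
    (f w s)%:E) (-oo)%R)%E.
  apply: (f_O w uninf) => //.
  move=> Lc' t tt0; apply: (constant_before_minimum l0_lin l0_pos l1_lin l1_pos
    l1_V l01 g_cont gac g_gt0 g' w_cont wac w_bnd fw_ge0 w' (lexx t0)) => //.
  by move=> s; rewrite -Lc'.
move=> /limf_esup_gt0_frequently[q q0 qX].
apply: (contradiction _ 1 q _ omega_le M0 l1M' ltr01 q0 qX).
  exact: f_loc.
apply: filterS l01 => t lt tt0; rewrite mul1r lerDr mulr_ge0 //.
by rewrite subr_ge0 lt.
Qed.
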